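(* Let $k,n$ be positive integers and let $G$ be a connected graph with $n$ vertices. Then: (i) $G$ has a spanning subgraph belonging to $\mathcal{F}_{k,n}$ if and only if $G=G_1*_{k'}G_2$ for some integer $k'\ge k$ and graphs $G_1,G_2$ such that, for each $i=1,2$, either $\eta(G_i)\ge k$ or $G_i=K_1$. (ii) $G$ is a spanning subgraph of some graph belonging to $\mathcal{F}_{k,n}$ if and only if $\kappa'(G)\le k$ and $\gamma(G)\le k$.
   Context: Graphs are finite, loopless, possibly with multiple edges. $\kappa'(G)$ is the edge connectivity; $\tau(G)$ is the maximum number of edge-disjoint spanning trees of a connected graph $G$. $\omega(G)$ is the number of components. For a nontrivial graph $G$, $d(G)=\frac{|E(G)|}{|V(G)|-\omega(G)}$, $\eta(G)=\min\frac{|X|}{\omega(G-X)-\omega(G)}$ over $X\subseteq E(G)$ with nonzero denominator, and $\gamma(G)=\max d(H)$ over subgraphs $H$ of $G$ with nonzero denominator. For vertex-disjoint connected graphs $G_1,G_2$ and a set $K$ of $m$ edges each having one end in $V(G_1)$ and the other in $V(G_2)$, the $m$-edge-join $G_1*_m G_2$ is the graph with vertex set $V(G_1)\cup V(G_2)$ and edge set $E(G_1)\cup E(G_2)\cup K$. For $n>1$, $\mathcal{F}_{k,n}$ is the set of graphs $H$ on $n$ vertices with $\kappa'(H)=\tau(H)=k$ whose number of edges is minimum among all graphs on $n$ vertices with $\kappa'=\tau=k$. *)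

(* Defs.v *)
From HB Require Import structures.
From mathcomp Require Import all_boot all_order all_algebra.
Set Implicit Arguments. Unset Strict Implicit. Unset Printing Implicit Defensive.
Import Order.TTheory GRing.Theory Num.Theory.
Local Open Scope ring_scope.

(* A finite loopless multigraph on the vertex type V: an arbitrary finite
   type of edges, each edge having two (distinct) ends.  Edges are
   undirected: src/dst is only a labelling of the two ends. *)
Record mgraph (V : finType) := MGraph {
  edge : finType;
  src : edge -> V;
  dst : edge -> V;
  loopless : forall e, src e != dst e }.

Section Graphs.
Variable V : finType.
Implicit Types G H : mgraph V.

Definition ends G (e : edge G) : {set V} := [set src e; dst e].

Definition adj G : rel V := fun x y =>
  [exists e : edge G, ((src e == x) && (dst e == y)) || ((src e == y) && (dst e == x))].

Definition omega G : nat :=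
  #|[set [set y | connect (adj G) x y] | x : V]|.

Definition connected G : bool := omega G == 1%N.

Definition restrict G (S : {set edge G}) : mgraph V :=
  @MGraph V {e : edge G | e \in S} (fun e => src (val e)) (fun e => dst (val e))
    (fun e => loopless (val e)).

Definition edel G (X : {set edge G}) : mgraph V := restrict (~: X).

Definition deg G (v : V) : nat := #|[set e : edge G | v \in ends e]|.

Definition is_cycle G (C : {set edge G}) : bool :=
  [&& C != set0,
      [forall v, (deg (restrict C) v == 0%N) || (deg (restrict C) v == 2%N)] &
      [forall u, forall v, ((0 < deg (restrict C) u)%N && (0 < deg (restrict C) v)%N)
                        ==> connect (adj (restrict C)) u v]].

Definition acyclic G : bool := [forall C : {set edge G}, ~~ is_cycle C].

Definition spanning_tree G (T : {set edge G}) : bool :=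
  connected (restrict T) && acyclic (restrict T).

Definition has_trees G (t : nat) : bool :=
  [exists Ts : {ffun 'I_t -> {set edge G}},
     [forall i, spanning_tree (Ts i)] &&
     [forall i, forall j, (i != j) ==> [disjoint Ts i & Ts j]]].

(* tau(G): maximum number of edge-disjoint spanning trees
   (a spanning tree of a graph with >= 2 vertices has an edge, so t <= |E|) *)
Definition tau G : nat := \max_(t < #|edge G|.+1 | has_trees G t) t.

(* kappa'(G): edge connectivity, min |X| with G - X disconnected
   (the default #|E| is attained by X = E when |V| >= 2) *)
Definition kappa' G : nat :=
  \big[minn/#|edge G|]_(X : {set edge G} | (1 < omega (edel X))%N) #|X|.

(* eta(G) = min |X| / (omega(G-X) - omega(G)) over X with nonzero denominator.
   The neutral element #|E| never changes the minimum when the index set is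
   nonempty, since then X = E is in it with value <= #|E|. *)
Definition eta G : rat :=
  \big[Num.min/(#|edge G|%:R)]_(X : {set edge G} | (omega G < omega (edel X))%N)
     ((#|X|%:R) / ((omega (edel X) - omega G)%N%:R)).

End Graphs.

Section Induced.
Variables (V : finType) (G : mgraph V) (A : {set V}).
Definition iedge := {e : edge G | (src e \in A) && (dst e \in A)}.
Definition isrc (e : iedge) : {x : V | x \in A} :=
  exist _ (src (val e)) (proj1 (andP (valP e))).
Definition idst (e : iedge) : {x : V | x \in A} :=
  exist _ (dst (val e)) (proj2 (andP (valP e))).
Lemma iloopless (e : iedge) : isrc e != idst e.
Proof.
apply/negP => /eqP H; have := loopless (val e).
by move: H => [->]; rewrite eqxx.
Qed.
Definition induced : mgraph {x : V | x \in A} := MGraph iloopless.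
End Induced.

Definition dens (V : finType) (G : mgraph V) : rat :=
  (#|edge G|%:R) / ((#|V| - omega G)%N%:R).

(* gamma(G) = max d(H) over subgraphs H = (A, S) of G with nonzero denominator
   (all values are >= 0, so the default 0 is harmless) *)
Definition gamma (V : finType) (G : mgraph V) : rat :=
  \big[Num.max/0]_(A : {set V})
    \big[Num.max/0]_(S : {set edge (induced G A)}
                       | (omega (restrict S) < #|A|)%N)
       dens (restrict S).

Definition spanning_sub (V : finType) (G H : mgraph V) : Prop :=
  exists f : edge G -> edge H, injective f /\ forall e, ends (f e) = ends e.

Definition in_F (k n : nat) (H : mgraph 'I_n) : Prop :=
  (1 < n)%N /\ kappa' H = k /\ tau H = k /\
  forall H' : mgraph 'I_n, kappa' H' = k -> tau H' = k ->
    (#|edge H| <= #|edge H'|)%N.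

(* G = G[V1] *_{m} G[~: V1]: both parts nonempty and connected, and exactly
   m edges between V1 and its complement *)
Definition edge_join (n : nat) (G : mgraph 'I_n) (V1 : {set 'I_n}) (m : nat) : Prop :=
  V1 != set0 /\ ~: V1 != set0 /\
  connected (induced G V1) /\ connected (induced G (~: V1)) /\
  #|[set e : edge G | (src e \in V1) (+) (dst e \in V1)]| = m.

(* Main.v *)
Require Import Defs.
From mathcomp Require Import all_boot all_order all_algebra.
Set Implicit Arguments. Unset Strict Implicit. Unset Printing Implicit Defensive.
Import Order.TTheory GRing.Theory Num.Theory.
Local Open Scope ring_scope.

(* Since k parallel copies of a tree lie in F_(k,n), its members are exactly the
   graphs that decompose into k spanning trees and have a cut of size k; each of
   these trees crosses that cut once, so removing the cut leaves k disjoint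
   spanning trees on either side. Tutte-Nash-Williams turns the latter into
   eta >= k, which gives (i). For (ii), if gamma G <= k then Nash-Williams
   splits G into k forests; moving the at most k edges of a minimum cut to
   distinct forests, the forests can be completed to spanning trees that each
   cross the cut once. Both packing theorems come from matroid union applied to
   the graphic matroid. *)

(** * Matroid union *)

(** Matroids enter through a closure operator, because for graphs the closure is plain connectivity
    of the ends. For graphs this fixes the number of class edges inside [A] at k times its rank |V|
    - omega, to be compared with the density bound on [A] for arboricity and with the deletion bound
    on its complement for packing.

    Minimality in [in_F] can be exploited only once the minimum is known to be k (n - 1). Then k
    disjoint spanning sets must use every edge, and their independence follows by counting; cycles
    appear only where [acyclic] has to be established. A cut with k edges bounds both kappa' and tau
    from above, and k spanning classes bound both from below, so one certificate settles both
    equalities. *)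

Section MatroidUnion.
Variables (E : finType) (cl : {set E} -> {set E}).
Hypothesis cl_ext : forall S : {set E}, S \subset cl S.
Hypothesis cl_min : forall S T : {set E}, S \subset cl T -> cl S \subset cl T.
Hypothesis cl_exch : forall (S : {set E}) e f,
  e \in cl (f |: S) -> e \notin cl S -> f \in cl (e |: S).

Definition indep (F : {set E}) := forall e, e \in F -> e \notin cl (F :\ e).

Lemma cl_mono (S T : {set E}) : S \subset T -> cl S \subset cl T.
Proof. by move=> sST; apply: cl_min; apply: subset_trans sST (cl_ext T). Qed.

Lemma indep_sub (F F' : {set E}) : F' \subset F -> indep F -> indep F'.
Proof.
move=> sF iF e eF'; apply: contra (iF e (subsetP sF _ eF')).
by apply: subsetP; apply: cl_mono; apply: setSD.
Qed.

Lemma indep_add (F : {set E}) e : indep F -> e \notin cl F -> indep (e |: F).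
Proof.
move=> iF eF.
have eNF : e \notin F by apply: contra eF; apply: subsetP (cl_ext F) _.
move=> g; have [-> _|neg] := eqVneq g e; first by rewrite setU1K.
rewrite in_setU1 (negPf neg) /= => gF; apply/negP => gcl.
have Eg : (e |: F) :\ g = e |: (F :\ g).
  by apply/setP => x; rewrite !inE; case: eqVneq => // ->; rewrite (negPf neg).
rewrite Eg in gcl; have := cl_exch gcl (iF g gF).
by rewrite setD1K // (negPf eF).
Qed.

Lemma basis_exists (S : {set E}) : exists B : {set E}, [/\ B \subset S, indep B & S \subset cl B].
Proof.
have [m] := ubnP #|S|; elim: m S => // m IH S ltS.
have [/existsP[e /andP[eS ecl]]|/existsPn nex] :=
  boolP [exists e, (e \in S) && (e \in cl (S :\ e))].
  have [|B [sB iB cB]] := IH (S :\ e).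
    by move: ltS; rewrite (cardsD1 e S) eS.
  exists B; split=> //; first exact: subset_trans sB (subD1set _ _).
  rewrite -(setD1K eS) subUset sub1set cB andbT.
  by apply: subsetP ecl; apply: cl_min.
exists S; split=> // e eS; move: (nex e); by rewrite eS.
Qed.

(* If the independent set [F] spans [e], the elements of the fundamental
   circuit of [e] already do. *)
Lemma circuit_spans (F : {set E}) e : indep F -> e \in cl F ->
  e \in cl [set f in F | e \notin cl (F :\ f)].
Proof.
move=> iF eF.
have [M [/andP[sMF eM] minM]] : exists M : {set E}, ((M \subset F) && (e \in cl M)) /\
    forall M' : {set E}, ((M' \subset F) && (e \in cl M')) -> (#|M| <= #|M'|)%N.
  have PF : (F \subset F) && (e \in cl F) by rewrite subxx.
  have [M PM minM] := @arg_minnP _ F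
    (fun M : {set E} => (M \subset F) && (e \in cl M)) (fun M => #|M|) PF.
  by exists M.
(* [M] is the fundamental circuit without [e]. If [F :\ f] still spanned [e] for some [f] of [M],
   exchange would put [f] itself into the span of [F :\ f]. *)
apply: (subsetP (cl_mono _)) (eM); apply/subsetP => f fM.
rewrite inE (subsetP sMF _ fM) /=; apply: contra (iF f (subsetP sMF _ fM)) => eFf.
have sMFf : M :\ f \subset F :\ f by exact: setSD.
have eNM : e \notin cl (M :\ f).
  apply/negP => eMf; have := minM (M :\ f).
  rewrite (subset_trans sMFf (subD1set _ _)) eMf => /(_ isT).
  by rewrite (cardsD1 f M) fM add1n ltnn.
have fcl : f \in cl (e |: (M :\ f)) by apply: cl_exch eNM; rewrite setD1K.
apply: subsetP fcl; apply: cl_min; rewrite subUset sub1set eFf.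
exact: subset_trans sMFf (cl_ext _).
Qed.

Section Union.
Variable k : nat.
Implicit Types c : {ffun E -> option 'I_k}.

Definition colour c i : {set E} := [set e | c e == Some i].
Definition uncoloured c : {set E} := [set e | c e == None].

Definition indepb (F : {set E}) := [forall e in F, e \notin cl (F :\ e)].
Lemma indepP F : reflect (indep F) (indepb F).
Proof. exact: forall_inP. Qed.

Definition valid c := [forall i, indepb (colour c i)].

Definition swap c e i f : {ffun E -> option 'I_k} :=
  [ffun x => if x == e then Some i else if x == f then None else c x].

(** An augmenting step: when class [i] spans [e], the side condition says that [f] lies on the
    fundamental circuit of [e], so trading them keeps the class independent and moves the hole from
    [e] to [f]. *)
Definition swap_step : rel {ffun E -> option 'I_k} := fun c c' =>
  [exists e, exists i, exists f, [&& c e == None, c f == Some i,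
     e \notin cl (colour c i :\ f) & c' == swap c e i f]].

Lemma colour_swap c e i f j : c e = None -> c f = Some i ->
  colour (swap c e i f) j = if j == i then e |: (colour c i :\ f) else colour c j.
Proof.
move=> ce cf; have nef : f != e by apply: contra_eq_neq cf => ->; rewrite ce.
case: eqP => [->|/eqP nji]; apply/setP => x; rewrite !inE ffunE.
  have [->|_] := eqVneq x e; first by rewrite eqxx.
  by have [->|_] := eqVneq x f.
have [->|_] := eqVneq x e.
  by rewrite ce; apply/negbTE/eqP => -[] Eij; rewrite Eij eqxx in nji.
have [->|_] := eqVneq x f => //.
by rewrite cf; apply/esym/negbTE/eqP => -[] Eij; rewrite Eij eqxx in nji.
Qed.

Lemma uncoloured_swap c e i f : c e = None -> c f = Some i ->
  uncoloured (swap c e i f) = f |: (uncoloured c :\ e).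
Proof.
move=> ce cf; have nef : f != e by apply: contra_eq_neq cf => ->; rewrite ce.
apply/setP => x; rewrite !inE ffunE.
have [->|_] := eqVneq x e; first by rewrite [e == f]eq_sym (negPf nef).
by have [->|_] := eqVneq x f.
Qed.

Lemma swap_valid c e i f : valid c -> c e = None -> c f = Some i ->
  e \notin cl (colour c i :\ f) ->
  valid (swap c e i f) /\ #|uncoloured (swap c e i f)| = #|uncoloured c|.
Proof.
move=> vc ce cf ncl; split.
  apply/forallP => j; rewrite colour_swap //.
  have /indepP iC := forallP vc i.
  case: eqP => _; last exact: (forallP vc j).
  by apply/indepP/indep_add => //; apply: indep_sub iC; exact: subD1set.
rewrite uncoloured_swap // cardsU1 !inE cf /= andbF /=.
by rewrite [in RHS](cardsD1 e) inE ce.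
Qed.

(* Start from a colouring with the fewest uncoloured elements and let [A]
   collect the elements left uncoloured by some colouring reachable by swaps;
   a swap never enlarges the span of a colour class within [A]. *)
Theorem matroid_union : exists (F : 'I_k -> {set E}) (A : {set E}),
  [/\ forall i, indep (F i),
      forall i j e, e \in F i -> e \in F j -> i = j,
      forall e, (forall i, e \notin F i) -> e \in A &
      forall i, A \subset cl (F i :&: A)].
Proof.
have v0 : valid [ffun=> None].
  by apply/forallP => i; apply/forall_inP => e; rewrite inE ffunE.
have [c vc minc] := @arg_minnP _ _ valid (fun c => #|uncoloured c|) v0.
pose A := [set e | [exists c', connect swap_step c c' && (c' e == None)]].
exists (colour c), A.
have reach c' : connect swap_step c c' -> valid c' /\ #|uncoloured c'| = #|uncoloured c|.
  move=> /connectP [p pth ->] {c'}.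
  elim: p c vc {minc A} pth => //= c1 p IH c vc /andP[st pth].
  case/existsP: st => e /existsP[i /existsP[f /and4P[/eqP ce /eqP cf ncl /eqP E1]]].
  have [v1 u1] := swap_valid vc ce cf ncl.
  by rewrite E1 in pth *; have [? ->] := IH _ v1 pth.
have spanned c' e i : connect swap_step c c' -> c' e = None ->
    e \in cl (colour c' i :&: A).
  move=> cc' ce; have [vc' uc'] := reach c' cc'.
  have iC : indep (colour c' i) by apply/indepP; exact: (forallP vc' i).
  have ecl : e \in cl (colour c' i).
    (* Otherwise [e] could receive colour [i], leaving fewer uncoloured elements than the
       minimum. *)
    apply/negPn/negP => ncl.
    pose c2 : {ffun E -> option 'I_k} := [ffun x => if x == e then Some i else c' x].
    have Ecol j : colour c2 j = if j == i then e |: colour c' i else colour c' j.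
      case: eqP => [->|/eqP nji]; apply/setP => x; rewrite !inE ffunE.
        by have [->|_] := eqVneq x e; rewrite ?eqxx.
      have [->|_] := eqVneq x e => //.
      by rewrite ce; apply/negbTE/eqP => -[] Eij; rewrite Eij eqxx in nji.
    have v2 : valid c2.
      apply/forallP => j; rewrite Ecol; case: eqP => _; last exact: (forallP vc' j).
      by apply/indepP/indep_add.
    have := minc c2 v2; rewrite -uc' leqNgt => /negP; apply.
    have -> : uncoloured c2 = uncoloured c' :\ e.
      by apply/setP => x; rewrite !inE ffunE; have [->|_] := eqVneq x e.
    by rewrite [in X in (_ < X)%N](cardsD1 e) inE ce.
  (* Each [f] of the fundamental circuit can be swapped with [e] and is then uncoloured, hence lies
     in [A]. *)
  apply: subsetP (circuit_spans iC ecl); apply: cl_mono; apply/subsetP => f.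
  rewrite !inE => /andP[/eqP cf ncl]; rewrite cf eqxx /=.
  apply/existsP; exists (swap c' e i f); rewrite ffunE.
  have nef : f != e by apply: contra_eq_neq cf => ->; rewrite ce.
  rewrite (negPf nef) !eqxx andbT; apply: connect_trans cc' (connect1 _).
  apply/existsP; exists e; apply/existsP; exists i; apply/existsP; exists f.
  by rewrite ce cf ncl !eqxx.
have shrink c' i : connect swap_step c c' -> cl (colour c' i :&: A) \subset cl (colour c i :&: A).
  move=> /connectP [p]; elim/last_ind: p c' => [|p c2 IH] c' /=; first by move=> _ ->.
  rewrite rcons_path last_rcons => /andP[pth st] -> {c'}.
  set c1 := last c p in st *.
  have cc1 : connect swap_step c c1 by apply/connectP; exists p.
  apply: subset_trans (IH c1 pth erefl).
  case/existsP: st => e /existsP[j /existsP[f /and4P[/eqP ce /eqP cf ncl /eqP ->]]].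
  rewrite colour_swap //; apply: cl_min; case: eqP => [->|_]; last exact: cl_ext.
  (* The only element that the swap adds is [e], which was uncoloured before it and so already
     spanned within [A]. *)
  apply/subsetP => x; rewrite inE => /andP[]; rewrite in_setU1 => /orP[/eqP -> _|].
    exact: spanned.
  rewrite in_setD1 => /andP[_ xc xA]; apply: (subsetP (cl_ext _)).
  by rewrite inE xc.
split.
- by move=> i; apply/indepP; exact: (forallP vc i).
- by move=> i j e; rewrite !inE => /eqP -> /eqP [].
- move=> e nF; rewrite inE; apply/existsP; exists c; rewrite connect0 /=.
  by case E1: (c e) => [i|//]; have := nF i; rewrite inE E1 eqxx.
- move=> i; apply/subsetP => e eA; move: (eA); rewrite inE => /existsP[c' /andP[cc' /eqP ce]].
  exact: (subsetP (shrink c' i cc')) (spanned c' e i cc' ce).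
Qed.

End Union.
End MatroidUnion.

(** * Connectivity and rank of edge sets *)

Section Connectivity.
Variables (V : finType) (G : mgraph V).
Implicit Types (S T X : {set edge G}) (e : edge G) (A : {set V}) (x y : V).

Definition conn S : rel V := connect (adj (restrict S)).

Lemma adj_restrictP S x y :
  reflect (exists2 e, e \in S & (src e = x /\ dst e = y) \/ (src e = y /\ dst e = x))
          (adj (restrict S) x y).
Proof.
apply: (iffP existsP) => [[[e eS] /= H]|[e eS H]].
  by exists e => //; case/orP: H => /andP[/eqP ? /eqP ?]; [left|right].
by exists (exist _ e eS) => /=; case: H => -[-> ->]; rewrite !eqxx ?orbT.
Qed.

Lemma adj_sym (H : mgraph V) : symmetric (adj H).
Proof. by move=> x y; apply/existsP/existsP => -[e He]; exists e; rewrite orbC. Qed.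

Lemma conn_sym S : symmetric (conn S).
Proof. by apply: sym_connect_sym; apply: adj_sym. Qed.

Lemma conn_refl S x : conn S x x. Proof. exact: connect0. Qed.

Lemma conn_trans S : transitive (conn S).
Proof. exact: connect_trans. Qed.

Lemma conn_edge S e : e \in S -> conn S (src e) (dst e).
Proof. by move=> eS; apply/connect1/adj_restrictP; exists e => //; left. Qed.

(** The substitute for walking along paths: a vertex predicate that no edge of [S] separates, such
    as a side of a cut, certifies that two vertices are not connected. *)
Lemma conn_closed S (P : pred V) x y : (forall e, e \in S -> P (src e) = P (dst e)) ->
  conn S x y -> P x = P y.
Proof.
move=> cP /connectP[p]; elim: p x => [|z p IH] x /=; first by move=> _ ->.
move=> /andP[/adj_restrictP[e eS Exz] pth] ly; rewrite -(IH z) //.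
by have := cP e eS; case: Exz => -[-> ->].
Qed.

Lemma conn_swap S u v x : conn S u v -> conn S x u = conn S x v.
Proof.
move=> uv; apply/idP/idP => H; first exact: conn_trans H uv.
by apply: conn_trans H _; rewrite conn_sym.
Qed.

Lemma conn_set0 x y : conn set0 x y = (x == y).
Proof.
apply/idP/eqP => [H|->]; last exact: conn_refl.
have /(_ _)/esym := @conn_closed set0 (pred1 x) x y _ H.
by rewrite /= eqxx => E; apply/esym/eqP/E => e; rewrite inE.
Qed.

Lemma adj_setT : adj (restrict [set: edge G]) =2 adj G.
Proof.
move=> x y; apply/adj_restrictP/existsP => [[e _ H]|[e H]].
  by exists e; case: H => -[-> ->]; rewrite !eqxx ?orbT.
by exists e => //; case/orP: H => /andP[/eqP ? /eqP ?]; [left|right].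
Qed.

Lemma omega_setT : omega (restrict [set: edge G]) = omega G.
Proof.
rewrite /omega; congr #|pred_of_set _|; apply: eq_imset => x; apply/setP => y.
by rewrite !inE (eq_connect adj_setT).
Qed.

Lemma conn_add S e x y : conn (e |: S) x y =
  [|| conn S x y, conn S x (src e) && conn S (dst e) y | conn S x (dst e) && conn S (src e) y].
Proof.
apply/idP/idP => [H|].
  pose P z := [|| conn S x z, conn S x (src e) && conn S (dst e) z
                 | conn S x (dst e) && conn S (src e) z].
  rewrite -/(P y) -(@conn_closed (e |: S) P x y) ?/P ?conn_refl //.
  move=> f; rewrite in_setU1 => /orP[/eqP->|fS]; last first.
    by rewrite !(conn_swap _ (conn_edge fS)).
  rewrite !conn_refl !andbT.
  by case: (conn S x (src e)); case: (conn S x (dst e)).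
have sub : forall u v, conn S u v -> conn (e |: S) u v.
  apply: connect_sub => u v /adj_restrictP[f fS E]; apply/connect1/adj_restrictP.
  by exists f => //; rewrite in_setU1 fS orbT.
have ee : conn (e |: S) (src e) (dst e) by apply: conn_edge; rewrite setU11.
case/or3P => [|/andP[H1 H2]|/andP[H1 H2]]; first exact: sub.
  exact: conn_trans (sub _ _ H1) (conn_trans ee (sub _ _ H2)).
rewrite conn_sym in ee.
exact: conn_trans (sub _ _ H1) (conn_trans ee (sub _ _ H2)).
Qed.

End Connectivity.

Section Transfer.
Variables (V W : finType) (G : mgraph V) (H : mgraph W) (phi : V -> W).
Variables (S : {set edge G}) (T : {set edge H}).
Hypothesis edgeP : forall e, e \in S -> conn T (phi (src e)) (phi (dst e)).

(** Edges need only map to connected pairs, not to edges. The same lemma thus serves spans ([phi]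
    the identity), induced subgraphs ([phi] the inclusion) and retractions onto a vertex set. *)
Lemma conn_transfer x y : conn S x y -> conn T (phi x) (phi y).
Proof.
move=> xy; rewrite -(@conn_closed _ _ S (fun z => conn T (phi x) (phi z)) x y) ?conn_refl //.
by move=> e /edgeP /conn_swap.
Qed.

Lemma omega_transfer : (forall w, exists v, w = phi v) ->
  (omega (restrict T) <= omega (restrict S))%N.
Proof.
move=> surj; pose m (B : {set V}) := [set y | [exists x in B, conn T (phi x) y]].
rewrite /omega; apply: leq_trans (leq_imset_card m _).
apply/subset_leq_card/subsetP => _ /imsetP[w _ ->]; have [x ->] := surj w.
apply/imsetP; exists [set y | conn S x y]; first by apply/imsetP; exists x.
apply/setP => y; rewrite !inE; apply/idP/existsP => [xy|[z /andP[]]].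
  by exists x; rewrite inE conn_refl.
by rewrite inE => /conn_transfer; apply: conn_trans.
Qed.

End Transfer.

Section Span.
Variables (V : finType) (G : mgraph V).
Implicit Types (S T X : {set edge G}) (e : edge G) (A : {set V}) (x y : V).

(** The closure operator of the cycle matroid of [G]. *)
Definition espan S : {set edge G} := [set e | conn S (src e) (dst e)].

Lemma espan_ext S : S \subset espan S.
Proof. by apply/subsetP => e eS; rewrite inE conn_edge. Qed.

Lemma conn_span S T x y : S \subset espan T -> conn S x y -> conn T x y.
Proof.
by move=> /subsetP sST; apply: (@conn_transfer _ _ _ _ id) => e /sST; rewrite inE.
Qed.

Lemma conn_sub S T x y : S \subset T -> conn S x y -> conn T x y.
Proof. by move=> sST; apply: conn_span; apply: subset_trans sST (espan_ext T). Qed.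

Lemma espan_min S T : S \subset espan T -> espan S \subset espan T.
Proof. by move=> sST; apply/subsetP => e; rewrite !inE; apply: conn_span. Qed.

Lemma espan_exch S e f : e \in espan (f |: S) -> e \notin espan S -> f \in espan (e |: S).
Proof.
rewrite !inE !conn_add => /or3P[->//|/andP[H1 H2] _|/andP[H1 H2] _].
  by rewrite [conn S (src f) (src e)]conn_sym [conn S (dst e) _]conn_sym H1 H2 orbT.
by rewrite H2 H1 !orbT.
Qed.

Lemma omega_anti S T : S \subset espan T -> (omega (restrict T) <= omega (restrict S))%N.
Proof.
move=> /subsetP sST; apply: (@omega_transfer _ _ _ _ id); last by move=> y; exists y.
by move=> e /sST; rewrite inE.
Qed.

Lemma omega_set0 : omega (restrict (set0 : {set edge G})) = #|V|.
Proof.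
rewrite /omega card_imset // => x y /setP/(_ x); rewrite !inE.
by rewrite -!/(conn _ _ _) conn_refl conn_set0 => /esym/eqP.
Qed.

Lemma omega_le_card S : (omega (restrict S) <= #|V|)%N.
Proof. by rewrite -omega_set0; apply/omega_anti/sub0set. Qed.

Lemma omega_add S e :
  (omega (restrict (e |: S)) + (e \notin espan S) = omega (restrict S))%N.
Proof.
have [eS|eS] := boolP (e \in espan S).
  rewrite addn0; apply/eqP; rewrite eqn_leq !omega_anti //.
    by rewrite subUset sub1set eS espan_ext.
  exact: subset_trans (subsetUr _ _) (espan_ext _).
rewrite /=; pose c T x := [set y | conn T x y].
pose u := src e; pose v := dst e; pose T := e |: S.
have nuv : ~~ conn S u v by move: eS; rewrite inE.
have cE U x y : (c U x == c U y) = conn U x y.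
  apply/eqP/idP => [/setP/(_ y)|H]; first by rewrite !inE conn_refl => ->.
  by apply/setP => z; rewrite !inE ![conn U _ z]conn_sym (conn_swap _ H).
(* [m] sends a component of [S] to the component of [T] containing it. Only the components of [u]
   and [v] merge, so without that of [u] it becomes a bijection. *)
pose m (B : {set V}) := [set y | [exists x in B, conn T x y]].
have mc x : m (c S x) = c T x.
  apply/setP => y; rewrite !inE; apply/existsP/idP => [[z /andP[]]|H].
    by rewrite inE => /(conn_sub (subsetUr [set e] S)); apply: conn_trans.
  by exists x; rewrite inE conn_refl.
have cu : c S u \in [set c S x | x in V] by apply/imsetP; exists u.
rewrite addn1 [RHS](cardsD1 (c S u)) cu add1n; congr _.+1.
rewrite -[in RHS](@card_in_imset _ _ m).
  congr #|pred_of_set _|; apply/setP => B; apply/imsetP/imsetP => [[x _ ->]|[B']].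
    have [xu|nxu] := boolP (conn S x u); last first.
      by exists (c S x); rewrite ?mc // !inE cE nxu; apply/imsetP; exists x.
    exists (c S v).
      by rewrite !inE cE conn_sym nuv; apply/imsetP; exists v.
    rewrite mc; apply/eqP; rewrite cE conn_add xu.
    by rewrite -/v conn_refl orbT.
  by rewrite !inE => /andP[_ /imsetP[x _ ->]] ->; exists x => //; rewrite mc.
move=> B1 B2; rewrite !inE => /andP[n1 /imsetP[x _ E1]] /andP[n2 /imsetP[y _ E2]].
move: n1 n2; rewrite E1 E2 !cE !mc => /negPf n1 /negPf n2 /eqP.
rewrite !cE conn_add n1 [conn S (src e) y]conn_sym -/u n2 andbF /= orbF => H.
by apply/eqP; rewrite cE.
Qed.

Lemma card_omega_ge S : (#|V| <= #|S| + omega (restrict S))%N.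
Proof.
have [m] := ubnP #|S|; elim: m S => // m IH S ltS.
have [->|[e eS]] := set_0Vmem S; first by rewrite omega_set0 cards0.
have := omega_add (S :\ e) e; rewrite setD1K // => E.
have := IH (S :\ e); rewrite (cardsD1 e S) eS -E in ltS * => /(_ ltS) H.
apply: leq_trans H _; rewrite addnA addnC -[X in (_ <= X)%N]addnA leq_add2r.
exact: leq_b1.
Qed.

(** In matroid terms the rank of an edge set is [#|V|] minus its component number: each edge of a
    forest lowers the latter by exactly one. *)
Lemma indep_card S : indep espan S -> (#|S| + omega (restrict S) = #|V|)%N.
Proof.
have [m] := ubnP #|S|; elim: m S => // m IH S ltS iS.
have [->|[e eS]] := set_0Vmem S; first by rewrite omega_set0 cards0.
have := omega_add (S :\ e) e; rewrite setD1K // (iS e eS) addn1 => E.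
rewrite (cardsD1 e S) eS in ltS *; rewrite add1n addSnnS E.
by apply: IH => //; apply: indep_sub iS; [exact: espan_ext|exact: espan_min|exact: subD1set].
Qed.

Lemma omega_setD S X : (omega (restrict (S :\: X)) <= omega (restrict S) + #|S :&: X|)%N.
Proof.
have [m] := ubnP #|S :&: X|; elim: m S => // m IH S ltS.
have [E|[e]] := set_0Vmem (S :&: X).
  rewrite E cards0 addn0 -[X in (_ <= omega (restrict X))%N](setID S X) E set0U //.
rewrite inE => /andP[eS eX].
have Ei : (S :\ e) :&: X = (S :&: X) :\ e by rewrite setIDAC.
have := IH (S :\ e); rewrite Ei (cardsD1 e (S :&: X)) inE eS eX in ltS * => /(_ ltS).
have -> : (S :\ e) :\: X = S :\: X.
  by apply/setP => x; rewrite !inE; case: eqVneq => //= ->; rewrite eX.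
move=> H; apply: leq_trans H _; rewrite addnA leq_add2r.
by rewrite -(omega_add (S :\ e) e) setD1K // leq_add2l leq_b1.
Qed.

Lemma connectedP S (x0 : V) : reflect (forall x y, conn S x y) (connected (restrict S)).
Proof.
apply: (iffP cards1P) => [[B EB] x y|H].
  have H z : [set y | conn S z y] = B.
    by apply/set1P; rewrite -EB; apply/imsetP; exists z.
  by have /setP/(_ y) := H x; rewrite -(H y) !inE conn_refl => ->.
exists setT; apply/setP => B; rewrite inE; apply/imsetP/eqP => [[x _ ->]|->].
  by apply/setP => y; rewrite !inE; exact: H.
by exists x0 => //; apply/setP => y; rewrite !inE; apply/esym/H.
Qed.

Definition spanning S := forall x y, conn S x y.

Lemma omega_spanning S : (0 < #|V|)%N -> spanning S -> omega (restrict S) = 1%N.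
Proof. by case/card_gt0P => x0 _ H; apply/eqP/(connectedP S x0). Qed.

Lemma omega_gt0 S : (0 < #|V|)%N -> (0 < omega (restrict S))%N.
Proof.
case/card_gt0P => x0 _; apply/card_gt0P; exists [set y | conn S x0 y].
by apply/imsetP; exists x0.
Qed.

Lemma omega_eq1_spanning S : (0 < #|V|)%N -> (omega (restrict S) <= 1)%N -> spanning S.
Proof.
move=> V0 H; case/card_gt0P: (V0) => x0 _.
by apply/(connectedP S x0); rewrite /connected eqn_leq H omega_gt0.
Qed.

Lemma spanning_card S : (0 < #|V|)%N -> spanning S -> (#|V|.-1 <= #|S|)%N.
Proof.
move=> V0 /(omega_spanning V0) E; have := card_omega_ge S.
by rewrite E addn1 -{1}(prednK V0).
Qed.

Lemma indep_spanning_card S : (0 < #|V|)%N -> indep espan S -> spanning S -> #|S| = #|V|.-1.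
Proof.
by move=> V0 /indep_card <- /(omega_spanning V0) ->; rewrite addn1.
Qed.

(** Deleting a spanned edge would leave a spanning set with fewer than [#|V|.-1] edges. This
    recovers trees from edge counts without handling cycles. *)
Lemma spanning_indep S : (0 < #|V|)%N -> spanning S -> (#|S| <= #|V|.-1)%N -> indep espan S.
Proof.
move=> V0 sS cS e eS; apply/negP => H.
have s' : spanning (S :\ e).
  move=> x y; apply: conn_span (sS x y); rewrite -{1}(setD1K eS) subUset sub1set H.
  exact: espan_ext.
have := spanning_card V0 s'.
by rewrite leqNgt => /negP; apply; apply: leq_trans cS; rewrite (cardsD1 e S) eS.
Qed.

Definition cut (A : {set V}) : {set edge G} := [set e | (src e \in A) (+) (dst e \in A)].

Lemma spanning_cut S A x y : spanning S -> x \in A -> y \notin A ->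
  exists2 e, e \in S & e \in cut A.
Proof.
move=> sS xA yA; apply/exists_inP; apply: contraR yA => /exists_inPn H.
have /= <- // := @conn_closed _ _ S [pred z | z \in A] x y _ (sS x y) => e eS.
by have := H e eS; rewrite inE negb_add => /eqP.
Qed.

Lemma conn_nocut S A x y : (forall e, e \in S -> e \notin cut A) -> conn S x y ->
  (x \in A) = (y \in A).
Proof.
move=> H; apply: (@conn_closed _ _ S [pred z | z \in A] x y) => /= e eS.
by have := H e eS; rewrite inE negb_add => /eqP.
Qed.

Lemma omega_edel_cut A x y : x \in A -> y \notin A -> (1 < omega (edel (cut A)))%N.
Proof.
move=> xA yA; rewrite ltnNge; apply/negP => H.
have V0 : (0 < #|V|)%N by apply/card_gt0P; exists x.
have /(_ x y) /(@conn_nocut _ A) := omega_eq1_spanning V0 H.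
rewrite xA (negPf yA); suff /[swap]/[apply] : forall e, e \in ~: cut A -> e \notin cut A by [].
by move=> e; rewrite inE.
Qed.

(** Turns the edge deletions in [kappa'] into cuts: a component of [G] minus [X] has all its
    boundary edges in [X]. *)
Lemma omega_edel_gt1 X : (1 < omega (edel X))%N ->
  exists A x y, [/\ x \in A, y \notin A & cut A \subset X].
Proof.
move=> H; have V0 : (0 < #|V|)%N by apply: leq_trans (omega_le_card (~: X)); apply: ltnW.
have [/existsP[x /existsP[y nxy]]|nex] := boolP [exists x, exists y, ~~ conn (~: X) x y].
  exists [set z | conn (~: X) x z], x, y; rewrite !inE conn_refl; split=> //.
  apply/subsetP => e; rewrite !inE; apply: contraLR => eX.
  by rewrite negb_add (conn_swap x (@conn_edge _ _ (~: X) e _)) ?inE.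
have : omega (edel X) = 1%N.
  apply: omega_spanning => // x y; apply: contraNT nex => nxy.
  by apply/existsP; exists x; apply/existsP; exists y.
by move=> E; rewrite E in H.
Qed.

End Span.

(** * Disjoint families and cycles *)

Section Ends.
Variables (V : finType) (G : mgraph V).

Lemma ends_eq2 (e : edge G) a b : ends e = [set a; b] ->
  (src e = a /\ dst e = b) \/ (src e = b /\ dst e = a).
Proof.
move=> E; have := loopless e.
have : src e \in ends e by rewrite !inE eqxx.
have : dst e \in ends e by rewrite !inE eqxx orbT.
by rewrite E !inE => /orP[] /eqP -> /orP[] /eqP ->; rewrite ?eqxx //; auto.
Qed.

Lemma conn_ends (e : edge G) a b (T : {set edge G}) : ends e = [set a; b] ->
  conn T a b = conn T (src e) (dst e).
Proof. by case/ends_eq2 => -[-> ->] //; rewrite conn_sym. Qed.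

Lemma cut_ends (e : edge G) a b (A : {set V}) : ends e = [set a; b] ->
  (e \in cut G A) = (a \in A) (+) (b \in A).
Proof. by rewrite inE; case/ends_eq2 => -[-> ->] //; rewrite addbC. Qed.

Lemma cutC (A : {set V}) : cut G (~: A) = cut G A.
Proof. by apply/setP => e; rewrite !inE addbN addNb negbK. Qed.

End Ends.

(** A connection between the ends of [e] through other edges of the preimage is carried by [phi] to
    one for [f e] in [S]; dependence passes forward, so independence passes back. *)
Lemma preim_indep (V W : finType) (G : mgraph V) (H : mgraph W) (phi : V -> W)
    (f : edge G -> edge H) (S : {set edge H}) :
  injective f -> (forall e, ends (f e) = [set phi (src e); phi (dst e)]) ->
  indep (@espan _ H) S -> indep (@espan _ G) (f @^-1: S).
Proof.
move=> fi fE iS e; rewrite inE => eS; apply: contra (iS _ eS); rewrite !inE.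
rewrite -(conn_ends _ (fE e)); apply: conn_transfer => g; rewrite !inE => /andP[ng gS].
by rewrite (conn_ends _ (fE g)) conn_edge // !inE gS (inj_eq fi) ng.
Qed.

Section Families.
Variables (E : finType) (k : nat).
Implicit Types F : 'I_k -> {set E}.

Definition disj F := forall i j e, e \in F i -> e \in F j -> i = j.

Lemma sum_card_disj F (X : {set E}) : disj F ->
  (\sum_i #|F i :&: X| = #|X :&: \bigcup_i F i|)%N.
Proof.
move=> dF; have -> : X :&: \bigcup_i F i = \bigcup_i (X :&: F i) by rewrite big_distrr.
rewrite -sum1_card partition_disjoint_bigcup => [|i j nij].
  by apply: eq_bigr => i _; rewrite sum1_card setIC.
rewrite -setI_eq0; apply/eqP/setP => e; rewrite !inE.
by apply/negP => /andP[/andP[_ Hi] /andP[_ Hj]]; rewrite (dF i j e) ?eqxx in nij.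
Qed.

Lemma sum_card_disj_le F (X : {set E}) : disj F -> (\sum_i #|F i :&: X| <= #|X|)%N.
Proof. by move=> dF; rewrite sum_card_disj // subset_leq_card ?subsetIl. Qed.

Lemma sum_tight (a b : 'I_k -> nat) : (forall i, a i <= b i)%N ->
  (\sum_i b i <= \sum_i a i)%N -> forall i, a i = b i.
Proof.
move=> ab le; have lei i : true -> (a i <= b i ?= iff (a i == b i))%N by split.
have [_] := leqif_sum lei; have -> : (\sum_i a i == \sum_i b i)%N.
  by rewrite eqn_leq le andbT leq_sum.
by move=> /esym/forallP H i; apply/eqP; exact: H.
Qed.

End Families.

Section Cycles.
Variables (V : finType) (G : mgraph V).

Lemma deg_restrict (C : {set edge G}) v :
  deg (restrict C) v = #|[set e in C | v \in ends e]|.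
Proof.
rewrite /deg -(card_imset _ val_inj); congr #|pred_of_set _|.
apply/setP => e; rewrite inE; apply/imsetP/andP => [[[g gC]]|[eC ve]].
  by rewrite inE => vg ->; split.
by exists (exist _ e eC) => //; rewrite inE; exact: ve.
Qed.

(* Otherwise the side of [e] containing [src e] would be a vertex set with an
   odd degree sum. *)
Lemma cycle_conn (C : {set edge G}) e : is_cycle C -> e \in C ->
  conn (C :\ e) (src e) (dst e).
Proof.
move=> /and3P[_ /forallP degC _] eC; apply/negPn/negP => ne.
pose A := [set y | conn (C :\ e) (src e) y].
have ev : (2 %| \sum_(v in A) deg (restrict C) v)%N.
  by apply: dvdn_sum => v _; case/orP: (degC v) => /eqP ->.
move: ev; under eq_bigr => v _ do rewrite deg_restrict -sum1dep_card big_mkcondr /=.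
(* Counting by edges: [e] has exactly one end in [A], every other edge of [C] none or two. *)
rewrite exchange_big /= (bigD1 e eC) /= dvdn_addl.
  rewrite -big_mkcondr /= sum1dep_card.
  have -> : [set v | (v \in A) && (v \in ends e)] = [set src e].
    apply/setP => v; rewrite !inE; have [->|_] := eqVneq v (src e); first by rewrite conn_refl.
    by have [->|] := eqVneq v (dst e); rewrite ?andbF // (negPf ne).
  by rewrite cards1.
apply: dvdn_sum => f /andP[fC nfe]; rewrite -big_mkcondr /= sum1dep_card.
have Ef : (src f \in A) = (dst f \in A).
  by rewrite !inE; apply: conn_swap; apply: conn_edge; rewrite !inE nfe.
have [sA|sA] := boolP (src f \in A).
  have -> : [set v | (v \in A) && (v \in ends f)] = ends f; last by rewrite cards2 loopless.
  apply/setP => v; rewrite inE; apply: andb_idl; rewrite !in_setU !in_set1.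
  by case/orP => /eqP ->; rewrite -?Ef.
suff -> : [set v | (v \in A) && (v \in ends f)] = set0 by rewrite cards0.
apply/setP => v; rewrite inE [RHS]inE; apply/negP => /andP[vA]; rewrite !in_setU !in_set1.
by case/orP => /eqP Ev; rewrite Ev -?Ef in vA; rewrite vA in sA.
Qed.

End Cycles.

Lemma indep_acyclic (V : finType) (G : mgraph V) (T : {set edge G}) :
  indep (@espan _ G) T -> acyclic (restrict T).
Proof.
move=> iT; apply/forallP => C; apply/negP => cC.
have /set0Pn[e eC] : C != set0 by case/and3P: cC.
have := iT (val e) (valP e); rewrite inE => /negP; apply.
refine (@conn_transfer V V (restrict T) G id (C :\ e) (T :\ val e) _ _ _ (cycle_conn cC eC)) => g.
rewrite !inE => /andP[nge _]; apply: (@conn_edge _ _ _ (val g)).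
by rewrite !inE (inj_eq val_inj) nge (valP g).
Qed.

(** * Tree packing and arboricity *)

Section Invariants.
Variables (V : finType) (G : mgraph V).

Lemma kappa'_geP m : reflect
  ((m <= #|edge G|)%N /\ forall X : {set edge G}, (1 < omega (edel X))%N -> (m <= #|X|)%N)
  (m <= kappa' G)%N.
Proof.
rewrite /kappa' -minEnat -leEnat.
exact: (@bigmin_geP _ nat _ #|edge G| m _ (fun X : {set edge G} => #|X|)).
Qed.

Lemma kappa'_le (X : {set edge G}) : (1 < omega (edel X))%N -> (kappa' G <= #|X|)%N.
Proof. by have /kappa'_geP[_] := leqnn (kappa' G); apply. Qed.

Lemma kappa'_attained : (1 < #|V|)%N ->
  exists2 X : {set edge G}, (1 < omega (edel X))%N & #|X| = kappa' G.
Proof.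
move=> V1; rewrite /kappa'; elim/big_ind: _ => [|_ _ [X HX <-] [Y HY <-]|X HX].
(* The default [#|edge G|] is the value at the full edge set, whose deletion leaves at least two
   isolated vertices. *)
- by exists setT; rewrite ?cardsT // /edel setCT omega_set0.
- by rewrite /minn; case: ifP => _; [exists X|exists Y].
- by exists X.
Qed.

Lemma kappa'_cut : (1 < #|V|)%N ->
  exists (A : {set V}) x y, [/\ x \in A, y \notin A & (#|cut G A| <= kappa' G)%N].
Proof.
case/kappa'_attained => X /omega_edel_gt1 [A [x [y [xA yA sAX]]]] <-.
by exists A, x, y; rewrite subset_leq_card.
Qed.

Lemma has_treesI t (F : 'I_t -> {set edge G}) : disj F ->
  (forall i, spanning (F i)) -> (forall i, indep (@espan _ G) (F i)) ->
  (0 < #|V|)%N -> has_trees G t.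
Proof.
move=> dF sF iF /card_gt0P[x0 _]; apply/existsP; exists [ffun i => F i].
apply/andP; split; apply/forallP => i; rewrite !ffunE.
  by rewrite /spanning_tree indep_acyclic // andbT; apply/(connectedP _ x0); exact: sF.
apply/forallP => j; rewrite ffunE; apply/implyP; apply: contraR => /pred0Pn[e /andP[ei ej]].
by rewrite (dF i j e).
Qed.

Lemma has_treesE t : (0 < #|V|)%N -> has_trees G t ->
  exists F : 'I_t -> {set edge G}, disj F /\ forall i, spanning (F i).
Proof.
case/card_gt0P => x0 _ /existsP[F /andP[/forallP sF /forallP dF]]; exists F; split.
  move=> i j e ei ej; apply/eqP; apply: contraT => nij.
  by have /implyP/(_ nij)/pred0P/(_ e) := forallP (dF i) j; rewrite /= ei ej.
by move=> i; have /andP[/(connectedP _ x0)] := sF i.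
Qed.

Lemma tau_attained : (0 < tau G)%N -> has_trees G (tau G).
Proof.
rewrite /tau; elim/big_ind: _ => // m1 m2 H1 H2.
by rewrite /maxn; case: ifP.
Qed.

Lemma spanning_family_cut k (F : 'I_k -> {set edge G}) (A : {set V}) x y :
  disj F -> (forall i, spanning (F i)) -> x \in A -> y \notin A -> (k <= #|cut G A|)%N.
Proof.
move=> dF sF xA yA; apply: leq_trans (sum_card_disj_le (cut G A) dF).
rewrite -[k in (k <= _)%N]card_ord -sum1_card; apply: leq_sum => i _.
have [e ei eA] := spanning_cut (sF i) xA yA.
by apply/card_gt0P; exists e; rewrite inE ei.
Qed.

Lemma spanning_family_card k (F : 'I_k -> {set edge G}) : (0 < #|V|)%N ->
  disj F -> (forall i, spanning (F i)) -> (k * #|V|.-1 <= #|edge G|)%N.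
Proof.
move=> V0 dF sF; rewrite -[#|edge G|]cardsT; apply: leq_trans (sum_card_disj_le setT dF).
rewrite -[k in (k * _)%N]card_ord -sum_nat_const; apply: leq_sum => i _.
by rewrite setIT spanning_card.
Qed.

(** The easy half of Tutte-Nash-Williams: removing [X] from a spanning set raises its component
    number by at most the number of edges it shares with [X], and over disjoint sets these numbers
    add up to at most [#|X|]. *)
Lemma spanning_family_eta k (F : 'I_k -> {set edge G}) (X : {set edge G}) :
  (0 < #|V|)%N -> disj F -> (forall i, spanning (F i)) ->
  (k * (omega (edel X)).-1 <= #|X|)%N.
Proof.
move=> V0 dF sF; apply: leq_trans (sum_card_disj_le X dF).
rewrite -[k in (k * _)%N]card_ord -sum_nat_const; apply: leq_sum => i _.
have := omega_setD (F i) X; rewrite (omega_spanning V0 (sF i)) => H.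
rewrite -subn1 leq_subLR; apply: leq_trans H.
by apply/omega_anti/(subset_trans _ (espan_ext _)); rewrite setDE subsetIr.
Qed.

(* The covering form of the matroid union theorem gives both the
   Tutte-Nash-Williams theorem and the Nash-Williams arboricity theorem. *)
Lemma graph_union k : exists (F : 'I_k -> {set edge G}) (A : {set edge G}),
  [/\ disj F, forall i, indep (@espan _ G) (F i), ~: A \subset \bigcup_i F i &
      (\sum_i #|F i :&: A| = k * (#|V| - omega (restrict A)))%N].
Proof.
have [F [A [iF dF cF sF]]] := matroid_union (@espan_ext _ G) (@espan_min _ G) (@espan_exch _ G) k.
exists F, A; split=> //.
  apply/subsetP => e; rewrite inE; apply: contraR => nF; apply: cF => i.
  by apply: contra nF => ei; apply/bigcupP; exists i.
rewrite -[k in RHS]card_ord -sum_nat_const; apply: eq_bigr => i _.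
have iFA : indep (@espan _ G) (F i :&: A).
  by apply: indep_sub (iF i); [exact: espan_ext|exact: espan_min|exact: subsetIl].
rewrite -(indep_card iFA); have -> : omega (restrict (F i :&: A)) = omega (restrict A).
  apply/eqP; rewrite eqn_leq !omega_anti //.
  exact: subset_trans (subsetIr _ _) (espan_ext _).
by rewrite addnK.
Qed.

(** Each forest has at most [#|V|.-1] edges, so it suffices that together they reach [k] times that
    number. Inside [A] they have exactly [k] times its rank; the edges outside are all used, and the
    hypothesis for [X = ~: A] supplies the rest. *)
Theorem tutte_nash_williams k : (0 < #|V|)%N ->
  (forall X : {set edge G}, (k * (omega (edel X)).-1 <= #|X|)%N) ->
  exists F : 'I_k -> {set edge G}, disj F /\ forall i, spanning (F i).
Proof.
move=> V0 HX; have [F [A [dF iF cF sF]]] := graph_union k; exists F; split=> // i.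
have bnd j : (#|F j| <= #|V|.-1)%N.
  rewrite -ltnS (prednK V0) -(indep_card (iF j)) -[X in (X < _)%N]addn0 ltn_add2l.
  exact: omega_gt0.
suff /(sum_tight bnd)/(_ i) Ei : (\sum_(j < k) #|V|.-1 <= \sum_j #|F j|)%N.
  apply: omega_eq1_spanning => //; rewrite -(leq_add2l #|F i|) (indep_card (iF i)) Ei.
  by rewrite addn1 (prednK V0).
rewrite sum_nat_const card_ord.
have -> : (\sum_j #|F j| = \sum_j #|F j :&: A| + #|~: A|)%N.
  have E X : (\sum_j #|F j :&: X| = #|X :&: \bigcup_j F j|)%N by exact: sum_card_disj.
  rewrite -[#|~: A|](_ : (\sum_j #|F j :&: ~: A| = _)%N).
    by rewrite -big_split /=; apply: eq_bigr => j _; rewrite -setDE cardsID.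
  by rewrite E; congr #|pred_of_set _|; apply/setIidPl.
have := HX (~: A); rewrite /edel setCK => HA; rewrite sF.
apply: leq_trans (leq_add (leqnn _) HA); rewrite -mulnDr leq_mul2l; apply/orP; right.
have := omega_le_card A; have := omega_gt0 A V0.
case: (omega (restrict A)) => // w _ /= wV.
by rewrite -subn1 leq_subLR add1n -addnS subnK.
Qed.

(** The classes have [k] times the rank of [A] edges inside [A], by hypothesis at least [#|A|], so
    disjointness forces them to cover [A] too. *)
Theorem nash_williams_arboricity k :
  (forall S : {set edge G}, (#|S| <= k * (#|V| - omega (restrict S)))%N) ->
  exists F : 'I_k -> {set edge G},
    [/\ disj F, forall i, indep (@espan _ G) (F i) & forall e, exists i, e \in F i].
Proof.
move=> HS; have [F [A [dF iF cF sF]]] := graph_union k; exists F; split=> // e.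
suff : e \in \bigcup_i F i by case/bigcupP => i _ ei; exists i.
have [eA|eA] := boolP (e \in A); last by apply: (subsetP cF); rewrite inE.
have : A :&: \bigcup_i F i = A.
  by apply/eqP; rewrite eqEcard subsetIl -sum_card_disj // sF HS.
by move=> E; move: eA; rewrite -E inE => /andP[].
Qed.

End Invariants.

(** * Forest partitions and minimum graphs *)

Section ForestPartitions.
Variable k : nat.

Definition covers (E : finType) (F : 'I_k -> {set E}) := forall e, exists i, e \in F i.

Lemma sum_card_cover (E : finType) (F : 'I_k -> {set E}) (X : {set E}) :
  disj F -> covers F -> (\sum_i #|F i :&: X| = #|X|)%N.
Proof.
move=> dF cF; rewrite sum_card_disj //; congr #|pred_of_set _|; apply/setIidPl.
by apply/subsetP => e _; have [i ei] := cF e; apply/bigcupP; exists i.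
Qed.

(** The invariant of the constructions below: forests compatible with a cut of at most [k] edges.
    Once every class spans and both sides of the cut are nonempty, it certifies [kappa' = tau = k]
    for positive [k]. *)
Definition forest_partition (V : finType) (G : mgraph V) (A : {set V})
    (F : 'I_k -> {set edge G}) :=
  [/\ disj F, covers F, forall i, indep (@espan _ G) (F i)
    & forall i, (#|F i :&: cut G A| <= 1)%N].

Section AddEdge.
Variables (V : finType) (G : mgraph V) (x y : V) (nxy : x != y).

Lemma add_edge_loopless (e : option (edge G)) : oapp (@src V G) x e != oapp (@dst V G) y e.
Proof. by case: e => [e|] //=; apply: loopless. Qed.

Definition add_edge : mgraph V := MGraph add_edge_loopless.

Variables (A : {set V}) (F : 'I_k -> {set edge G}) (i0 : 'I_k).

Definition add_family (i : 'I_k) : {set edge add_edge} :=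
  [set e : option (edge G) | if e is Some e' then e' \in F i else i == i0].

Lemma add_edge_conn (S : {set edge G}) (S' : {set edge add_edge}) u v :
  (forall e, e \in S' -> if e is Some e' then e' \in S else false) ->
  conn S' u v -> conn S u v.
Proof.
move=> sS; refine (@conn_transfer V V add_edge G id S' S _ u v) => -[e|] /sS //.
exact: conn_edge.
Qed.

Lemma add_forest_partition : forest_partition A F -> ~~ conn (F i0) x y ->
  ((x \in A) (+) (y \in A) -> F i0 :&: cut G A = set0) ->
  forest_partition A add_family.
Proof.
move=> [dF cF iF tF] nc ncut; split.
- by move=> i j [e|]; rewrite !inE; [apply: dF|move=> /eqP -> /eqP ->].
- move=> [e|]; last by exists i0; rewrite inE eqxx.
  by have [i ei] := cF e; exists i; rewrite inE.
- move=> i [e|].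
    rewrite !inE => ei; apply: contra (iF i e ei) => H; rewrite inE.
    have [Ei|ni] := eqVneq i i0; last first.
      apply: add_edge_conn H => -[f|]; last by rewrite !inE (negPf ni) andbF.
      by rewrite !inE => /andP[nf ->]; rewrite andbT; apply: contra nf => /eqP ->.
    subst i; set S' := _ :\ _ in H.
    have ES : S' = (None : edge add_edge) |:
        [set e' : edge add_edge | if e' is Some f then f \in F i0 :\ e else false].
      by apply/setP => -[f|]; rewrite !inE ?eqxx.
    (* If the new edge [None] closed a circuit through [e], exchange would make [F i0 :\ e] connect
       [x] and [y]. *)
    apply/negPn/negP => ne; case/negP: nc.
    have : (None : edge add_edge) \in espan ((Some e : edge add_edge) |:
       [set e' : edge add_edge | if e' is Some f then f \in F i0 :\ e else false]).
      apply: espan_exch; first by rewrite inE -ES.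
      rewrite inE; apply: contra ne; apply: add_edge_conn => -[f|]; by rewrite !inE.
    rewrite inE; apply: add_edge_conn => -[f|]; rewrite !inE //.
    by case/orP => [/eqP[->]|/andP[]].
  rewrite inE => /eqP ->; rewrite inE; apply: contra nc; apply: add_edge_conn => -[f|].
    by rewrite !inE.
  by rewrite !inE eqxx.
- move=> i; pose B := [set e : edge add_edge |
    if e is Some f then f \in F i :&: cut G A else false].
  have cB : #|B| = #|F i :&: cut G A|.
    rewrite -[RHS](card_imset _ (@Some_inj _)); apply: eq_card => -[f|]; rewrite inE.
      by rewrite mem_imset //; exact: Some_inj.
    by apply/esym/negbTE/imsetP => -[].
  (* Only in the first case does a class gain a cut edge, and by [ncut] it had none. *)
  have [E|nE] := boolP ((i == i0) && ((x \in A) (+) (y \in A))).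
    case/andP: E => /eqP Ei xyA; subst i.
    rewrite [X in #|pred_of_set X|](_ : _ = [set (None : edge add_edge)]) ?cards1 //.
    apply/setP => -[f|]; rewrite !inE ?eqxx //.
    by have /setP/(_ f) := ncut xyA; rewrite !inE.
  rewrite [X in #|pred_of_set X|](_ : _ = B) ?cB //.
  by apply/setP => -[f|]; rewrite !inE //=; apply: negbTE.
Qed.

End AddEdge.

(* A disconnected class can always be enlarged while meeting the cut at most
   once: join two components inside [A] or inside its complement, and when
   neither is possible the class has no cut edge yet. *)
Lemma extend_forest_partition (V : finType) (G : mgraph V) (A : {set V})
    (F : 'I_k -> {set edge G}) : (0 < #|V|)%N -> forest_partition A F ->
  exists (H : mgraph V) (F' : 'I_k -> {set edge H}),
    [/\ spanning_sub G H, forest_partition A F' & forall i, spanning (F' i)].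
Proof.
(* Induction on the slack: [k] forests have at most [k * #|V|] edges in total, so edges can be added
   only finitely often. *)
move=> V0; have [m] := ubnP (k * #|V| - #|edge G|)%N.
elim: m G F => // m IH G F ltm pF.
have [/forallP sF|] := boolP [forall i, forall x, forall y, conn (F i) x y].
  exists G, F; split=> //; first by exists id; split=> [a b|].
  by move=> i x y; have /forallP/(_ x)/forallP/(_ y) := sF i.
rewrite negb_forall => /existsP[i]; rewrite negb_forall => /existsP[x0].
rewrite negb_forall => /existsP[y0 n0].
have [x [y [nxy cxy]]] : exists x y, ~~ conn (F i) x y /\
    ((x \in A) (+) (y \in A) -> F i :&: cut G A = set0).
  have [/existsP[x /existsP[y /andP[xy nxy]]]|nex] :=
    boolP [exists x, exists y, ~~ ((x \in A) (+) (y \in A)) && ~~ conn (F i) x y].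
    by exists x, y; split=> //; rewrite (negPf xy).
  have same x y : (x \in A) = (y \in A) -> conn (F i) x y.
    move=> xy; apply: contraNT nex => nc; apply/existsP; exists x; apply/existsP; exists y.
    by rewrite xy addbb.
  (* Each side of [A] now lies in one component of the class, so a cut edge in the class would join
     [x0] to [y0]. *)
  exists x0, y0; split=> // xyA; apply/setP => e; rewrite inE [RHS]inE inE.
  apply/negP => /andP[ei eA]; case/negP: n0; have ce := conn_edge ei.
  have [E|E] := boolP ((x0 \in A) == (src e \in A)).
    have E2 : (dst e \in A) = (y0 \in A).
      by move: E eA xyA; do 4 case: (_ \in A).
    exact: conn_trans (same _ _ (eqP E)) (conn_trans ce (same _ _ E2)).
  have E1 : (x0 \in A) = (dst e \in A) by move: E eA; do 3 case: (_ \in A).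
  have E2 : (src e \in A) = (y0 \in A) by move: E eA xyA; do 4 case: (_ \in A).
  by rewrite conn_sym in ce; exact: conn_trans (same _ _ E1) (conn_trans ce (same _ _ E2)).
have nxy' : x != y by apply: contra nxy => /eqP ->; apply: conn_refl.
have pF' := add_forest_partition nxy' pF nxy cxy.
have [|H [F' [sH pH sF]]] := IH _ _ _ pF'.
  rewrite -ltnS; apply: leq_trans ltm; rewrite ltnS.
  have [dF' cF' iF' _] := pF'.
  have cE : #|edge (add_edge G nxy')| = #|edge G|.+1 by exact: card_option.
  have : (#|edge (add_edge G nxy')| <= k * #|V|)%N.
    rewrite -[#|edge _|]cardsT -(sum_card_cover _ dF' cF') -[k in (k * _)%N]card_ord -sum_nat_const.
    by apply: leq_sum => j _; rewrite setIT -(indep_card (iF' j)) leq_addr.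
  by rewrite cE subnS => H; rewrite prednK // subn_gt0.
exists H, F'; split=> //; case: sH => f [fi fE].
exists (fun e => f (Some e)); split; first by move=> a b /fi [].
by move=> e; rewrite fE.
Qed.

End ForestPartitions.

Lemma kappa'_tau_forest_partition k (V : finType) (H : mgraph V) (A : {set V}) x y
    (F : 'I_k -> {set edge H}) : (0 < k)%N -> x \in A -> y \notin A ->
  forest_partition A F -> (forall i, spanning (F i)) -> kappa' H = k /\ tau H = k.
Proof.
move=> k0 xA yA [dF cF iF tF] sF.
have V0 : (0 < #|V|)%N by apply/card_gt0P; exists x.
have V1 : (0 < #|V|.-1)%N.
  have : (1 < #|V|)%N.
    apply/card_gt1P; exists x, y; split=> //.
    by apply: contraNneq yA => <-.
  by case: #|V| => [|[]].
(* [#|edge H|] is the default value in [kappa'] and bounds the index in [tau], so both lower bounds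
   require it to be at least [k]. *)
have kE : (k <= #|edge H|)%N.
  by apply: leq_trans (spanning_family_card V0 dF sF); apply: leq_pmulr.
have cut_le : (#|cut H A| <= k)%N.
  rewrite -(sum_card_cover _ dF cF) -[k in (_ <= k)%N]card_ord -sum1_card.
  by apply: leq_sum.
split; apply/eqP; rewrite eqn_leq; apply/andP; split.
- by apply: leq_trans cut_le; apply: kappa'_le; apply: omega_edel_cut xA yA.
- apply/kappa'_geP; split=> // X /omega_edel_gt1 [B [u [v [uB vB sB]]]].
  exact: leq_trans (spanning_family_cut dF sF uB vB) (subset_leq_card sB).
- apply/bigmax_leqP => t /(has_treesE V0) [F' [dF' sF']].
  exact: leq_trans (spanning_family_cut dF' sF' xA yA) cut_le.
- have ht : has_trees H k by exact: has_treesI dF sF iF V0.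
  rewrite /tau.
  by apply: (@leq_bigmax_cond _ _ (fun t : 'I__ => nat_of_ord t)
    (Ordinal (kE : (k < #|edge H|.+1)%N))).
Qed.

Section MinimumGraphs.
Variables (k n : nat).
Hypotheses (k_gt0 : (0 < k)%N) (n_gt1 : (1 < n)%N).

Let card_gt0 : (0 < #|'I_n|)%N. Proof. by rewrite card_ord ltnW. Qed.

Lemma tau_edges (H : mgraph 'I_n) : tau H = k -> (k * n.-1 <= #|edge H|)%N.
Proof.
move=> tH; have : has_trees H (tau H) by apply: tau_attained; rewrite tH.
rewrite tH => /(has_treesE card_gt0) [F [dF sF]].
by have := spanning_family_card card_gt0 dF sF; rewrite card_ord.
Qed.

Lemma edges_forest_partition (H : mgraph 'I_n) A (F : 'I_k -> {set edge H}) :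
  forest_partition A F -> (forall i, spanning (F i)) -> #|edge H| = (k * n.-1)%N.
Proof.
move=> [dF cF iF _] sF; rewrite -[LHS]cardsT -(sum_card_cover _ dF cF).
rewrite -[k in RHS]card_ord -sum_nat_const; apply: eq_bigr => i _.
by rewrite setIT indep_spanning_card // card_ord.
Qed.

Lemma forest_partition_in_F (H : mgraph 'I_n) (A : {set 'I_n}) x y (F : 'I_k -> {set edge H}) :
  x \in A -> y \notin A -> forest_partition A F -> (forall i, spanning (F i)) ->
  in_F k H.
Proof.
move=> xA yA pF sF; have [kH tH] := kappa'_tau_forest_partition k_gt0 xA yA pF sF.
split=> //; split=> //; split=> // H' _ tH'.
by rewrite (edges_forest_partition pF sF) tau_edges.
Qed.

(** Fixes the minimum in [in_F] at [k * n.-1]. The witness extends [k] empty forests on the edgeless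
    graph, with a single vertex as one side of the cut. *)
Lemma in_F_exists : exists2 H : mgraph 'I_n, in_F k H & #|edge H| = (k * n.-1)%N.
Proof.
pose x := Ordinal (ltnW n_gt1); pose y := Ordinal n_gt1.
have l0 (e : void) : (of_void 'I_n e) != (of_void 'I_n e) by case: e.
pose G0 := MGraph l0.
have p0 : forest_partition [set x] (fun _ : 'I_k => set0 : {set edge G0}).
  by split=> [i j []|[]|i []|i] //; rewrite set0I cards0.
have [H [F [_ pF sF]]] := extend_forest_partition card_gt0 p0.
exists H; last exact: edges_forest_partition pF sF.
by apply: (@forest_partition_in_F H [set x] x y F) => //; rewrite inE.
Qed.

(** The [k] disjoint spanning sets need [n.-1] edges each, and [k * n.-1] is all there is, so each
    is a tree and no edge is left over. *)
Lemma in_F_trees (H : mgraph 'I_n) : in_F k H -> exists F : 'I_k -> {set edge H},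
  [/\ disj F, covers F, forall i, indep (@espan _ H) (F i) & forall i, spanning (F i)].
Proof.
move=> [_ [kH [tH minH]]]; have [H0 [_ [kH0 [tH0 _]]] cH0] := in_F_exists.
have cH : #|edge H| = (k * n.-1)%N.
  by apply/eqP; rewrite eqn_leq tau_edges // andbT -cH0 minH.
have : has_trees H (tau H) by apply: tau_attained; rewrite tH.
rewrite tH => /(has_treesE card_gt0) [F [dF sF]]; exists F.
have sumF : (\sum_i #|F i| = #|\bigcup_i F i|)%N.
  rewrite -[\bigcup_i F i]setTI -(sum_card_disj _ dF).
  by apply: eq_bigr => i _; rewrite setIT.
have lower i : (n.-1 <= #|F i|)%N by have := spanning_card card_gt0 (sF i); rewrite card_ord.
have upper : (\sum_i #|F i| <= \sum_(i < k) n.-1)%N.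
  by rewrite sumF sum_nat_const card_ord -cH max_card.
have eqF := sum_tight lower upper.
have cov : \bigcup_i F i = setT.
  apply/eqP; rewrite eqEcard subsetT cardsT cH -sumF -[k in (k * _)%N]card_ord -sum_nat_const.
  exact: leq_sum.
split=> // [e|i].
  have : e \in \bigcup_i F i by rewrite cov inE.
  by case/bigcupP => i _ ei; exists i.
by apply: spanning_indep => //; rewrite card_ord -eqF.
Qed.

End MinimumGraphs.

(** * Strength, fractional arboricity and induced subgraphs *)

(** With [G] connected the denominator is [(omega (edel X)).-1], and sets [X] that do not disconnect
    [G] give a trivial inequality. *)
Lemma eta_geP (V : finType) (G : mgraph V) (k : nat) : (1 < #|V|)%N -> connected G ->
  reflect (forall X : {set edge G}, (k * (omega (edel X)).-1 <= #|X|)%N) (k%:R <= eta G).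
Proof.
move=> V1 /eqP oG.
have val X : (omega G < omega (edel X))%N ->
   (k%:R <= (#|X|%:R / (omega (edel X) - omega G)%N%:R : rat)) =
   (k * (omega (edel X)).-1 <= #|X|)%N.
  rewrite oG subn1 => H; rewrite ler_pdivlMr -?natrM ?ler_nat //.
  by rewrite ltr0n; case: (omega _) H.
apply: (iffP (bigmin_geP _ _ _ _)) => [[_ H] X|H].
  have [/[dup] HX /H|] := boolP (omega G < omega (edel X))%N; first by rewrite val.
  by rewrite oG -leqNgt; case: (omega _) => [|[]] //; rewrite muln0.
split=> [|X HX]; last by rewrite val.
(* The default [#|edge G|] is bounded below through the deletion of all edges, as [#|V|.-1] is
   positive. *)
have := H setT; rewrite /edel setCT omega_set0 cardsT ler_nat; apply: leq_trans.
by rewrite leq_pmulr //; case: #|V| V1 => [|[]].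
Qed.

(** The arboricity condition ranges over edge sets of [G], so the densities of subgraphs on all
    vertices suffice; these live on a subtype of [V], whence the transport of [S] to
    [induced G setT]. *)
Lemma gamma_bound (V : finType) (G : mgraph V) (k : nat) : gamma G <= k%:R ->
  forall S : {set edge G}, (#|S| <= k * (#|V| - omega (restrict S)))%N.
Proof.
move=> /bigmax_leP[_ /(_ setT isT)/bigmax_leP[_ gS]] S.
have [->|/set0Pn[e0 e0S]] := eqVneq S set0; first by rewrite cards0.
pose S' : {set edge (induced G setT)} := [set e : iedge G setT | val e \in S].
have inS (e : edge G) : (src e \in [set: V]) && (dst e \in [set: V]) by rewrite !inE.
pose up (e : edge G) : edge (induced G setT) := Sub e (inS e).
have cS : #|S'| = #|S|.
  rewrite -[LHS](card_imset _ (@val_inj _ _ (iedge G setT))); apply: eq_card => e.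
  apply/imsetP/idP => [[e']|eS]; first by rewrite inE => eS ->.
  by exists (up e); rewrite ?inE.
have cV : #|{: {x : V | x \in [set: V]}}| = #|V| by rewrite card_sig cardsT.
have oS : (omega (restrict S) <= omega (restrict S'))%N.
  apply: (@omega_transfer _ _ (induced G setT) G val) => [e|w].
    by rewrite inE => /conn_edge.
  by exists (Sub w (in_setT w)).
(* A nonempty [S] makes the denominator nonzero: already [e0] merges two vertices. *)
have lt : (omega (restrict S') < #|V|)%N.
  rewrite -cV -(@omega_set0 _ (induced G setT)) -(omega_add set0 (up e0)).
  have -> : up e0 \notin espan (set0 : {set edge (induced G setT)}).
    by rewrite inE conn_set0 loopless.
  rewrite addn1 ltnS; apply: omega_anti; apply: subset_trans (espan_ext _).
  by rewrite setU0 sub1set inE.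
have := gS S'; rewrite cardsT => /(_ lt).
rewrite /dens cV card_sig ler_pdivrMr; last by rewrite ltr0n subn_gt0.
rewrite -natrM ler_nat => H; rewrite -cS; apply: leq_trans H _.
by rewrite leq_mul2l leq_sub2l ?orbT.
Qed.

Lemma forest_cover_card (V : finType) (G : mgraph V) k (F : 'I_k -> {set edge G}) :
  disj F -> covers F -> (forall i, indep (@espan _ G) (F i)) ->
  (#|edge G| <= k * (#|V| - omega G))%N.
Proof.
move=> dF cF iF; rewrite -[#|edge G|]cardsT -(sum_card_cover _ dF cF).
rewrite -[k in (k * _)%N]card_ord -sum_nat_const; apply: leq_sum => i _.
rewrite setIT -(indep_card (iF i)) -(omega_setT G) -[leqLHS](addnK (omega (restrict (F i)))).
by apply: leq_sub2l; apply/omega_anti/(subset_trans (subsetT _) (espan_ext _)).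
Qed.

(** The forests of [H] pull back to [k] forests covering any subgraph of [G], which bounds its edges
    by [k] times its rank. *)
Lemma gamma_le (V : finType) (G H : mgraph V) k (F : 'I_k -> {set edge H}) :
  spanning_sub G H -> disj F -> covers F -> (forall i, indep (@espan _ H) (F i)) ->
  gamma G <= k%:R.
Proof.
move=> [f [fi fE]] dF cF iF; apply: bigmax_le => // A _; apply: bigmax_le => // S ltS.
pose g (e : edge (restrict S)) := f (val (val e)).
have gi : injective g by move=> a b /fi /val_inj /val_inj.
have gE e : ends (g e) = [set val (src e); val (dst e)] by exact: fE.
have := @forest_cover_card _ (restrict S) k (fun i => g @^-1: F i).
have cA : #|{: {x : V | x \in A}}| = #|A| by rewrite card_sig.
rewrite /dens cA ler_pdivrMr ?ltr0n ?subn_gt0 // -natrM ler_nat; apply.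
- by move=> i j e; rewrite !inE; apply: dF.
- by move=> e; have [i ei] := cF (g e); exists i; rewrite inE.
- by move=> i; apply: (preim_indep (phi := val)) gi gE (iF i).
Qed.

Section Induced.
Variables (V : finType) (G : mgraph V) (k : nat).

(** A connection from a vertex of [A] that used the only cut edge would end outside [A], so each
    class stays connected inside [A]. *)
Lemma induced_spanning (A : {set V}) (F : 'I_k -> {set edge G}) :
  disj F -> (forall i, spanning (F i)) -> (forall i, (#|F i :&: cut G A| <= 1)%N) ->
  exists F1 : 'I_k -> {set edge (induced G A)}, disj F1 /\ forall i, spanning (F1 i).
Proof.
move=> dF sF tF; exists (fun i => [set e : iedge G A | val e \in F i]); split.
  by move=> i j e; rewrite !inE; apply: dF.
move=> i a b; set T := F i :\: cut G A.
have Tcut e : e \in T -> e \notin cut G A by rewrite inE => /andP[].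
have ab : conn T (val a) (val b).
  have := sF i (val a) (val b); have [E|[e eFA]] := set_0Vmem (F i :&: cut G A).
    by rewrite -[F i](setID _ (cut G A)) E set0U.
  have -> : F i = e |: T.
    rewrite -[F i in LHS](setID _ (cut G A)); congr (_ :|: _).
    apply/esym/eqP; rewrite eqEcard sub1set eFA cards1; exact: tF.
  have [aA bA] := (valP a, valP b).
  have eA : (src e \in A) (+) (dst e \in A) by move: eFA; rewrite !inE => /andP[].
  rewrite conn_add => /or3P[//|/andP[]|/andP[]] /(conn_nocut Tcut) H1 /(conn_nocut Tcut) H2;
  by move: eA; rewrite H2 -H1 aA bA.
(* [phi] retracts the vertices onto [A], collapsing everything outside to [a]. Edges of [T] avoid
   the cut, so each lies inside [A] or is collapsed. *)
pose phi (z : V) : {x : V | x \in A} := insubd a z.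
have phiK c : phi (val c) = c by exact: valKd.
rewrite -[a]phiK -[b]phiK; apply: conn_transfer ab => e eT.
have Ee : (src e \in A) = (dst e \in A).
  by have := Tcut e eT; rewrite inE negb_add => /eqP.
have [sA|sA] := boolP (src e \in A); last first.
  have -> : phi (src e) = a by rewrite /phi /insubd insubN.
  have -> : phi (dst e) = a by rewrite /phi /insubd insubN // -Ee.
  exact: conn_refl.
have dA : (src e \in A) && (dst e \in A) by rewrite -Ee sA.
pose e' : edge (induced G A) := Sub e dA.
have -> : phi (src e) = src e' by apply: val_inj; rewrite insubdK.
have -> : phi (dst e) = dst e' by apply: val_inj; rewrite insubdK // -Ee.
by apply: conn_edge; rewrite !inE /=; move: eT; rewrite inE => /andP[].
Qed.

Lemma induced_connected (A : {set V}) x (F : {set edge (induced G A)}) :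
  x \in A -> spanning F -> connected (induced G A).
Proof.
move=> xA sF; rewrite /connected -omega_setT.
apply/(connectedP _ (Sub x xA)) => a b; exact: conn_sub (subsetT _) (sF a b).
Qed.

Lemma join_spanning (A : {set V}) (F1 : 'I_k -> {set edge (induced G A)})
    (F2 : 'I_k -> {set edge (induced G (~: A))}) :
  (k <= #|cut G A|)%N -> disj F1 -> disj F2 ->
  (forall i, spanning (F1 i)) -> (forall i, spanning (F2 i)) ->
  exists F : 'I_k -> {set edge G},
    [/\ disj F, forall i, spanning (F i) & forall i, (#|F i :&: cut G A| <= 1)%N].
Proof.
move=> kA d1 d2 s1 s2.
(* [k] distinct cut edges, one to link [F1 i] with [F2 i] for each [i]. *)
pose g (i : 'I_k) : edge G := enum_val (widen_ord kA i).
have gA i : g i \in cut G A by exact: enum_valP.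
have gi : injective g by move=> i j /enum_val_inj /(congr1 val) /= /val_inj.
pose v1 (e : iedge G A) := val e; pose v2 (e : iedge G (~: A)) := val e.
pose F i := g i |: ((v1 @: F1 i) :|: (v2 @: F2 i)).
have inF i e : (e \in F i) = [|| e == g i, e \in v1 @: F1 i | e \in v2 @: F2 i].
  by rewrite in_setU1 in_setU.
have n1 e : v1 e \notin cut G A by rewrite inE; case/andP: (valP e) => -> ->.
have n2 e : v2 e \notin cut G A by rewrite -cutC inE; case/andP: (valP e) => -> ->.
have n12 e1 e2 : v1 e1 = v2 e2 -> False.
  have /andP[s1e _] := valP e1; have /andP[s2e _] := valP e2.
  by move=> E; move: s2e; rewrite -[val e2]/(v2 e2) -E inE s1e.
exists F; split.
- move=> i j e; rewrite !inF.
  case/or3P => [/eqP->|/imsetP[e1 e1i ->]|/imsetP[e2 e2i ->]].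
  + case/or3P => [/eqP/gi //|/imsetP[e' _ E]|/imsetP[e' _ E]].
      by case/negP: (n1 e'); rewrite -E.
    by case/negP: (n2 e'); rewrite -E.
  + case/or3P => [/eqP E|/imsetP[e' e'j /val_inj E]|/imsetP[e' _ /n12] //].
      by case/negP: (n1 e1); rewrite E.
    by apply: d1 e1i _; rewrite E.
  + case/or3P => [/eqP E|/imsetP[e' _ /esym/n12] //|/imsetP[e' e'j /val_inj E]].
      by case/negP: (n2 e2); rewrite E.
    by apply: d2 e2i _; rewrite E.
- move=> i; have c1 x y : x \in A -> y \in A -> conn (F i) x y.
    move=> xA yA; rewrite -[x]/(val (Sub x xA : {z | z \in A}))
      -[y]/(val (Sub y yA : {z | z \in A})).
    apply: (@conn_transfer _ _ (induced G A) G val (F1 i)) (s1 i _ _) => e ei.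
    apply: (@conn_edge _ _ _ (v1 e)); rewrite inF imset_f ?orbT //.
  have c2 x y : x \in ~: A -> y \in ~: A -> conn (F i) x y.
    move=> xA yA; rewrite -[x]/(val (Sub x xA : {z | z \in ~: A}))
      -[y]/(val (Sub y yA : {z | z \in ~: A})).
    apply: (@conn_transfer _ _ (induced G (~: A)) G val (F2 i)) (s2 i _ _) => e ei.
    apply: (@conn_edge _ _ _ (v2 e)); rewrite inF (imset_f v2) ?orbT //.
  have [a [b [aA bA ab]]] : exists a b, [/\ a \in A, b \in ~: A & conn (F i) a b].
    have gF : conn (F i) (src (g i)) (dst (g i)) by apply: conn_edge; rewrite inF eqxx.
    have := gA i; rewrite inE; have [sA dA|sA dA] := boolP (src (g i) \in A).
      by exists (src (g i)), (dst (g i)); rewrite inE.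
    by exists (dst (g i)), (src (g i)); rewrite inE conn_sym.
  have cA x : conn (F i) a x.
    have [xA|xA] := boolP (x \in A); first exact: c1.
    by apply: conn_trans ab (c2 _ _ bA _); rewrite inE.
  by move=> x y; apply: conn_trans (cA y); rewrite conn_sym.
- move=> i; rewrite -(cards1 (g i)); apply/subset_leq_card/subsetP => e.
  rewrite in_setI inF in_set1 => /andP[/or3P[//|/imsetP[e' _ ->]|/imsetP[e' _ ->]]].
    by rewrite (negPf (n1 e')).
  by rewrite (negPf (n2 e')).
Qed.

Lemma induced_trees (A : {set V}) : connected (induced G A) ->
  k%:R <= eta (induced G A) \/ #|A| = 1%N ->
  exists F : 'I_k -> {set edge (induced G A)}, disj F /\ forall i, spanning (F i).
Proof.
have cA : #|{: {x : V | x \in A}}| = #|A| by rewrite card_sig.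
move=> oA H; have [/eqP A1|A1] := boolP (#|A| == 1%N).
  exists (fun _ => set0); split=> [i j e|i a b]; first by rewrite inE.
  have /fintype_le1P/(_ a) : (#|{: {x : V | x \in A}}| <= 1)%N by rewrite cA A1.
  by move=> E; rewrite (E b) conn_refl.
have A0 : (0 < #|A|)%N.
  rewrite -cA -(eqP oA); apply: leq_trans (omega_le_card setT); rewrite omega_setT.
  by [].
have A2 : (1 < #|{: {x : V | x \in A}}|)%N by rewrite cA; case: #|A| A0 A1 => [|[]].
case: H => [/(eta_geP k A2 oA) H|E]; last by rewrite E in A1.
by apply: tutte_nash_williams => //; apply: ltnW.
Qed.

End Induced.

(** * Spanning subgraphs and supergraphs in F *)

(** With at most [k] cut edges, the position of an edge in an enumeration of the cut serves as its
    class. Stripped of cut edges, a forest connects nothing across the cut, so one crossing edge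
    keeps it independent. *)
Lemma spread_cut (V : finType) (G : mgraph V) (A : {set V}) k (F : 'I_k -> {set edge G}) :
  (#|cut G A| <= k)%N -> disj F -> covers F -> (forall i, indep (@espan _ G) (F i)) ->
  exists F' : 'I_k -> {set edge G}, forest_partition A F'.
Proof.
move=> cA dF cF iF; pose C (i : 'I_k) := [set e in cut G A | index e (enum (cut G A)) == i].
have C1 i e e' : e \in C i -> e' \in C i -> e = e'.
  rewrite !inE => /andP[eA /eqP Ee] /andP[e'A /eqP Ee'].
  rewrite -(nth_index e (_ : e \in enum (cut G A))) ?mem_enum ?inE // Ee -Ee'.
  by rewrite nth_index // mem_enum inE.
have sC i e : e \in C i -> e \in cut G A by rewrite inE => /andP[].
exists (fun i => C i :|: (F i :\: cut G A)); split.
- move=> i j e; rewrite !in_setU !in_setD => /orP[ei|/andP[nA ei]] /orP[ej|/andP[nA' ej]].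
  + by move: ei ej; rewrite !inE => /andP[_ /eqP ->] /andP[_ /eqP]; apply: val_inj.
  + by rewrite (sC i e ei) in nA'.
  + by rewrite (sC j e ej) in nA.
  + exact: dF ei ej.
- move=> e; have [eA|eA] := boolP (e \in cut G A).
    have lt : (index e (enum (cut G A)) < k)%N.
      by apply: leq_trans cA; rewrite cardE index_mem mem_enum.
    by exists (Ordinal lt); rewrite in_setU inE eA eqxx.
  by have [i ei] := cF e; exists i; rewrite in_setU in_setD eA ei orbT.
- move=> i; have iD : indep (@espan _ G) (F i :\: cut G A).
    by apply: indep_sub (iF i); [exact: espan_ext|exact: espan_min|exact: subsetDl].
  have [->|[e ei]] := set_0Vmem (C i); first by rewrite set0U.
  have -> : C i = [set e].
    by apply/setP => e'; rewrite in_set1; apply/idP/eqP => [e'i|->//]; apply: C1 e'i ei.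
  apply: indep_add iD _; [exact: espan_ext|exact: espan_exch|].
  rewrite inE; apply/negP => /(@conn_nocut _ _ _ A) H.
  have := sC i e ei; rewrite inE H ?addbb // => e'.
  by rewrite in_setD => /andP[].
- have inC i e : e \in (C i :|: (F i :\: cut G A)) :&: cut G A -> e \in C i.
    by rewrite in_setI in_setU in_setD => /andP[/orP[//|/andP[/negPf ->]]].
  by move=> i; apply/card_le1_eqP => e e' /inC ei /inC e'i; exact: C1 e'i ei.
Qed.

Lemma spanning_induced_eta (V : finType) (G : mgraph V) (A : {set V}) x k
    (F : 'I_k -> {set edge (induced G A)}) :
  (0 < k)%N -> x \in A -> disj F -> (forall i, spanning (F i)) ->
  connected (induced G A) /\ (k%:R <= eta (induced G A) \/ #|A| = 1%N).
Proof.
move=> k0 xA dF sF; have cA : #|{: {x : V | x \in A}}| = #|A| by rewrite card_sig.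
have oA : connected (induced G A) by exact: induced_connected xA (sF (Ordinal k0)).
have A0 : (0 < #|A|)%N by apply/card_gt0P; exists x.
split=> //; have [/eqP A1|A1] := boolP (#|A| == 1%N); [by right|left].
have A2 : (1 < #|{: {x : V | x \in A}}|)%N by rewrite cA; case: #|A| A0 A1 => [|[]].
by apply/(eta_geP k A2 oA) => X; apply: spanning_family_eta dF sF; apply: ltnW.
Qed.

Lemma F_subgraph_join (k n : nat) (G H : mgraph 'I_n) : (0 < k)%N -> (1 < n)%N ->
  spanning_sub H G -> in_F k H ->
  exists (k' : nat) (V1 : {set 'I_n}),
      (k <= k')%N /\ edge_join G V1 k' /\
      (k%:R <= eta (induced G V1) \/ #|V1| = 1%N) /\
      (k%:R <= eta (induced G (~: V1)) \/ #|~: V1| = 1%N).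
Proof.
move=> k0 n1 [f [fi fE]] HF; have [F [dF cF iF sF]] := in_F_trees k0 n1 HF.
have [|A [x [y [xA yA cA]]]] := @kappa'_cut _ H; first by rewrite card_ord.
have {}cA : (#|cut H A| <= k)%N by case: HF => _ [<- _].
(* The [k] disjoint spanning trees share at most [k] cut edges and each needs one, so each has
   exactly one. *)
have tF i : #|F i :&: cut H A| = 1%N.
  apply/esym; move: i; apply: sum_tight => [i|].
    have [e ei eA] := spanning_cut (sF i) xA yA.
    by apply/card_gt0P; exists e; rewrite inE ei.
  by rewrite sum1_card card_ord; apply: leq_trans (sum_card_disj_le _ dF) cA.
pose F' i := f @: F i.
have dF' : disj F'.
  by move=> i j e /imsetP[a ai ->] /imsetP[b bj /fi E]; apply: dF ai _; rewrite E.
have sF' i : spanning (F' i).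
  move=> u v; refine (@conn_transfer _ _ H G id (F i) (F' i) _ u v (sF i u v)) => e ei.
  by rewrite (conn_ends _ (fE e)) conn_edge // imset_f.
have tF' i : (#|F' i :&: cut G A| <= 1)%N.
  rewrite -(tF i) -(card_imset _ fi); apply/subset_leq_card/subsetP => e.
  rewrite inE => /andP[/imsetP[a ai ->]]; rewrite (cut_ends _ (fE a)) => aA.
  by rewrite imset_f // !inE ai.
have yA' : y \in ~: A by rewrite inE.
have [F1 [d1 s1]] := induced_spanning dF' sF' tF'.
have [|F2 [d2 s2]] := @induced_spanning _ _ _ (~: A) _ dF' sF'; first by rewrite cutC.
have [o1 e1] := spanning_induced_eta k0 xA d1 s1.
have [o2 e2] := spanning_induced_eta k0 yA' d2 s2.
(* [G] may have more edges than [H] across this cut, hence [k'] can exceed [k]. *)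
exists #|cut G A|, A; split; first exact: spanning_family_cut dF' sF' xA yA.
split=> //; split; first by apply/set0Pn; exists x.
by split; first by apply/set0Pn; exists y.
Qed.

Lemma join_F_subgraph (k n : nat) (G : mgraph 'I_n) (A : {set 'I_n}) (k' : nat) :
  (0 < k)%N -> (1 < n)%N -> (k <= k')%N -> edge_join G A k' ->
  k%:R <= eta (induced G A) \/ #|A| = 1%N ->
  k%:R <= eta (induced G (~: A)) \/ #|~: A| = 1%N ->
  exists H : mgraph 'I_n, spanning_sub H G /\ in_F k H.
Proof.
move=> k0 n1 kk' [/set0Pn[x xA] [/set0Pn[y yA] [o1 [o2 cA]]]] /(induced_trees o1) [F1 [d1 s1]].
case/(induced_trees o2) => F2 [d2 s2]; rewrite inE in yA.
have kA : (k <= #|cut G A|)%N by rewrite -cA in kk'.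
have [F [dF sF tF]] := join_spanning kA d1 d2 s1 s2.
have [B HB] := fin_all_exists (fun i => basis_exists (@espan_ext _ G) (@espan_min _ G) (F i)).
have sB i : B i \subset F i by case: (HB i).
pose H := restrict (\bigcup_i B i); pose F' i : {set edge H} := val @^-1: B i.
exists H; split; first by exists val; split; [exact: val_inj|].
apply: (forest_partition_in_F k0 n1 (F := F') xA yA).
  split.
  - by move=> i j e; rewrite !inE => /(subsetP (sB i)) ei /(subsetP (sB j)); apply: dF ei.
  - by move=> e; case/bigcupP: (valP e) => i _ ei; exists i; rewrite inE.
  - by move=> i; apply: (@preim_indep _ _ H G id) => //; [exact: val_inj|case: (HB i)].
  - move=> i; apply: leq_trans (tF i); rewrite -(card_imset _ (@val_inj _ _ (edge H))).
    apply/subset_leq_card/subsetP => _ /imsetP[e + ->]; rewrite !inE => /andP[ei ->].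
    by rewrite (subsetP (sB i) _ ei).
move=> i u v; have uv : conn (B i) u v by apply: conn_span (sF i u v); case: (HB i).
refine (@conn_transfer _ _ G H id (B i) (F' i) _ u v uv) => e ei.
have eU : e \in \bigcup_i B i by apply/bigcupP; exists i.
by apply: (@conn_edge _ H _ (Sub e eU)); rewrite inE.
Qed.

Lemma F_supergraph_bounds (k n : nat) (G H : mgraph 'I_n) : (0 < k)%N -> (1 < n)%N ->
  in_F k H -> spanning_sub G H -> (kappa' G <= k)%N /\ gamma G <= k%:R.
Proof.
move=> k0 n1 HF GH; have [F [dF cF iF sF]] := in_F_trees k0 n1 HF.
split; last exact: gamma_le GH dF cF iF.
have [|A [x [y [xA yA cA]]]] := @kappa'_cut _ H; first by rewrite card_ord.
have {}cA : (#|cut H A| <= k)%N by case: HF => _ [<- _].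
apply: leq_trans (kappa'_le (omega_edel_cut G xA yA)) (leq_trans _ cA).
case: GH => f [fi fE]; rewrite -(card_imset _ fi); apply/subset_leq_card/subsetP.
by move=> _ /imsetP[e eA ->]; rewrite (cut_ends _ (fE e)); rewrite inE in eA.
Qed.

Lemma bounds_F_supergraph (k n : nat) (G : mgraph 'I_n) : (0 < k)%N -> (1 < n)%N ->
  (kappa' G <= k)%N -> gamma G <= k%:R ->
  exists H : mgraph 'I_n, in_F k H /\ spanning_sub G H.
Proof.
move=> k0 n1 kG /gamma_bound/nash_williams_arboricity [F [dF iF cF]].
have [|A [x [y [xA yA cA]]]] := @kappa'_cut _ G; first by rewrite card_ord.
have [F' pF'] := spread_cut (leq_trans cA kG) dF cF iF.
have [|H [F2 [GH pH sH]]] := extend_forest_partition _ pF'; first by rewrite card_ord ltnW.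
exists H; split; last exact: GH.
exact: (forest_partition_in_F k0 n1 xA yA pH sH).
Qed.

Theorem theorem5p1 (k n : nat) (G : mgraph 'I_n) :
  (0 < k)%N -> (1 < n)%N -> connected G ->
  ((exists H : mgraph 'I_n, spanning_sub H G /\ in_F k H) <->
   (exists (k' : nat) (V1 : {set 'I_n}),
      (k <= k')%N /\ edge_join G V1 k' /\
      (k%:R <= eta (induced G V1) \/ #|V1| = 1%N) /\
      (k%:R <= eta (induced G (~: V1)) \/ #|~: V1| = 1%N)))
  /\
  ((exists H : mgraph 'I_n, in_F k H /\ spanning_sub G H) <->
   ((kappa' G <= k)%N /\ gamma G <= k%:R)).
Proof.
move=> k0 n1 _; split; split.
- by case=> H [GH HF]; exact: F_subgraph_join k0 n1 GH HF.
- by case=> k' [A [kk' [jA [e1 e2]]]]; exact: join_F_subgraph k0 n1 kk' jA e1 e2.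
- by case=> H [HF GH]; exact: F_supergraph_bounds k0 n1 HF GH.
- by case=> kG gG; exact: bounds_F_supergraph.
Qed.
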